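(* Let $A$ be a finite alphabet, let $F\colon A^{\mathbb{Z}}\to A^{\mathbb{Z}}$ be a cellular automaton and let $\mu$ be a shift-ergodic Borel probability measure on $A^{\mathbb{Z}}$. Suppose that $F$ has a $\mu$-equicontinuous point, and let $\mu_c$ be the limit in Cesàro mean of the sequence $(\mu\circ F^{-n})_{n\in\mathbb{N}}$. Then $F$ is a $\mu_c$-equicontinuous cellular automaton, i.e. $\mu_c$-almost every point of $A^{\mathbb{Z}}$ is a $\mu_c$-equicontinuous point for $F$.
   Context: $A^{\mathbb{Z}}$ carries the product topology of the discrete topology on the finite set $A$. The shift is $\sigma(x)=(x_{i+1})_{i\in\mathbb{Z}}$. A cellular automaton is a continuous map $F\colon A^{\mathbb{Z}}\to A^{\mathbb{Z}}$ commuting with $\sigma$. A measure is shift-ergodic if it is $\sigma$-invariant and ergodic for $\sigma$. For $n\in\mathbb{N}$ ($\mathbb{N}$ contains $0$) and $x\in A^{\mathbb{Z}}$ put $C_n(x)=\{y: y_j=x_j \text{ for } -n\le j\le n\}$ and $B_n(x)=\{y: F^i(y)_j=F^i(x)_j \text{ for all } i\in\mathbb{N} \text{ and } -n\le j\le n\}$. For a Borel probability measure $\nu$ on $A^{\mathbb{Z}}$, a point $x$ is $\nu$-equicontinuous (also called $\nu$-almost equicontinuous) for $F$ if for all $m\in\mathbb{N}$, $\lim_{n\to\infty}\nu(C_n(x)\cap B_m(x))/\nu(C_n(x))=1$ (in particular $\nu(C_n(x))>0$ for all $n$). $F$ is a $\nu$-equicontinuous cellular automaton if the set of $\nu$-equicontinuous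 points has full $\nu$-measure. Under the hypotheses of the statement, the weak-$*$ limit $\mu_c=\lim_{n\to\infty}\frac1n\sum_{i=0}^{n-1}\mu\circ F^{-i}$ exists and is an $F$-invariant probability measure. *)

(* Defs.v *)
From HB Require Import structures.
From mathcomp Require Import all_boot all_order all_algebra.
From mathcomp Require Import all_classical all_reals all_analysis.

Set Implicit Arguments.
Unset Strict Implicit.
Unset Printing Implicit Defensive.
Import Order.TTheory GRing.Theory Num.Theory.
Import numFieldNormedType.Exports.
Local Open Scope classical_set_scope.
Local Open Scope ring_scope.

(* The chosen letter [point : A] only serves to inhabit the configuration
   space, which [measurableType] requires; an empty alphabet would carry no
   probability measure on its configuration space. *)
#[short(type="alphabetType")]
HB.structure Definition Alphabet := {A of Finite A & isPointed A}.

Definition config (A : Type) : Type := int -> A.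

HB.instance Definition _ (A : alphabetType) :=
  Topological.copy (config A) (prod_topology (fun _ : int => discrete_topology A)).

HB.instance Definition _ (A : alphabetType) :=
  isPointed.Build (config A) (fun=> point).

(* The measurable sets of [config A] are its Borel sets. *)
HB.instance Definition _ (A : alphabetType) :=
  Measurable.copy (config A) (g_sigma_algebraType (@open (config A))).

Section cellular_automata.
Context {A : alphabetType}.
Implicit Types (x y : config A) (F : config A -> config A).

Definition shift_map x : config A := fun i => x (i + 1).

Definition cellular_automaton F : Prop :=
  continuous F /\ (forall x, F (shift_map x) = shift_map (F x)).

Definition cylinder (n : nat) x : set (config A) :=
  [set y | forall j : int, - n%:Z <= j <= n%:Z -> y j = x j].

Definition tube F (n : nat) x : set (config A) :=
  [set y | forall (i : nat) (j : int), - n%:Z <= j <= n%:Z ->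
     iter i F y j = iter i F x j].

Context {R : realType}.
Implicit Types mu nu : probability (config A) R.

Definition shift_ergodic mu : Prop :=
  (forall B, measurable B -> mu (shift_map @^-1` B) = mu B) /\
  (forall B, measurable B -> shift_map @^-1` B = B ->
     mu B = 0%E \/ mu B = 1%E).

(* The positivity conjunct is implied by the limit, since [x / 0 = 0] in a
   field and the cylinders decrease with [n]; it records that the quotients
   are genuine. *)
Definition equicontinuous_point nu F x : Prop :=
  (forall n, (0 < nu (cylinder n x))%E) /\
  (forall m, (fun n => fine (nu (cylinder n x `&` tube F m x)) /
                       fine (nu (cylinder n x))) @ \oo --> (1 : R)).

Definition equicontinuous_CA nu F : Prop :=
  {ae nu, forall x, equicontinuous_point nu F x}.

(* A measure as soon as [F] is measurable; [integral] takes any set function. *)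
Definition cesaro_mean mu F (n : nat) : set (config A) -> \bar R :=
  fun B => ((n%:R^-1)%:E * \sum_(i < n) pushforward mu (iter i F) B)%E.

(* Weak-* convergence. *)
Definition cesaro_limit mu F nu : Prop :=
  forall f : config A -> R, continuous f ->
    (fun n => (\int[cesaro_mean mu F n]_x (f x)%:E)%E) @ \oo -->
      (\int[nu]_x (f x)%:E)%E.

End cellular_automata.

(* Main.v *)
Require Import Defs.
From mathcomp Require Import all_boot all_order all_algebra.
From mathcomp Require Import all_classical all_reals all_analysis.
From mathcomp Require Import zify.

(* Let r be a radius of F.  The tube W of width r around a mu-equicontinuous
   point has positive measure, so by ergodicity almost every y visits W at
   positions -k1 and k2 with k1, k2 arbitrarily large.  The two columns carry
   the same time evolution, hence between them y evolves like the spatially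
   periodic configuration of period k1 + k2 repeating its word: almost every y
   lies in a tube around a periodic configuration.  For a given period there are
   finitely many such configurations and F maps their tubes into one another,
   so the union E of the tubes of period at most N is closed with
   F(E) included in E; Cesaro averages then give mu_c(E) >= mu(E), and letting
   N grow, mu_c-almost every y lies in one of countably many tubes around
   periodic configurations.  The Lebesgue density theorem for cylinders, applied
   to these countably many closed sets, concludes. *)

Set Implicit Arguments.
Unset Strict Implicit.
Unset Printing Implicit Defensive.
Import Order.TTheory GRing.Theory Num.Theory.
Import numFieldNormedType.Exports.
Local Open Scope classical_set_scope.
Local Open Scope ring_scope.

(** * Cylinders, compactness and clopen hulls in the configuration space *)

Section topology.
Context {A : alphabetType}.
Implicit Types (x y z : config A) (B U : set (config A)).

Lemma cylinder_sym n x y : cylinder n x y -> cylinder n y x.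
Proof. by move=> h j hj; rewrite h. Qed.

Lemma cylinder_trans n x y z : cylinder n x y -> cylinder n y z -> cylinder n x z.
Proof. by move=> h1 h2 j hj; rewrite h2 // h1. Qed.

Lemma cylinder_eq n x y : cylinder n x y -> cylinder n y = cylinder n x.
Proof.
move=> h; apply/seteqP; split=> z; first exact: cylinder_trans.
by apply: cylinder_trans; exact: cylinder_sym.
Qed.

Lemma cylinder_le n m x : (n <= m)%N -> cylinder m x `<=` cylinder n x.
Proof. by move=> nm y h j hj; apply: h; lia. Qed.

Lemma coord_continuous (j : int) : continuous (fun x => x j : discrete_topology A).
Proof.
exact: (@proj_continuous int (fun=> discrete_topology A) j).
Qed.

Lemma coord_nbhs (j : int) x : \forall y \near x, y j = x j.
Proof.
have : nbhs (x j : discrete_topology A) [set x j].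
  exact: discrete_set1.
by move=> /(@coord_continuous j x).
Qed.

Lemma cylinder_nbhs n x : nbhs x (cylinder n x).
Proof.
have h (s : seq int) : nbhs x [set y | forall j, j \in s -> y j = x j].
  elim: s => [|j s IH]; first by apply: filterS filterT => y _ j; rewrite in_nil.
  apply: filterS2 (coord_nbhs j x) IH => y yj ys i.
  by rewrite inE => /orP[/eqP ->|/ys].
apply: filterS (h [seq i%:Z - n%:Z | i <- iota 0 (n.*2.+1)]) => y + j hj.
apply; apply/mapP; exists (absz (j + n%:Z)); last by lia.
by rewrite mem_iota; lia.
Qed.

Lemma nbhs_cylinder x U : nbhs x U -> exists n, cylinder n x `<=` U.
Proof.
pose G : set_system (config A) := filter_from setT (fun n : nat => cylinder n x).
have FG : Filter G.
  apply: filter_from_filter; first by exists 0%N.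
  move=> i j _ _; exists (maxn i j) => // y h; split.
    by apply: cylinder_le h; rewrite leq_maxl.
  by apply: cylinder_le h; rewrite leq_maxr.
have : G --> x.
  apply/cvg_sup => i; apply/cvg_image.
    by apply/seteqP; split=> // a _; exists (fun=> a).
  move=> V /= /nbhs_singleton Vx.
  (* The image under coordinate [i] has to be exactly [V]. The cylinder alone only yields the letter
     [x i], so the preimage of [V] is added. *)
  exists (cylinder `|i|%N x `|` (fun y => y i) @^-1` V).
    exists `|i|%N => // y; by left.
  apply/seteqP; split=> [a [y hy <-]|a Va].
    by case: hy => // h; rewrite h //; lia.
  by exists (fun=> a) => //; right.
by move=> /[apply] -[n _ hn]; exists n.
Qed.

Lemma config_compact : compact [set: config A].
Proof.
have := @tychonoff int (fun=> discrete_topology A) (fun=> setT).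
rewrite (_ : [set f | _] = setT); last by apply/seteqP; split.
by apply=> _; apply: finite_compact; exact: (@finite_finset A).
Qed.

Lemma open_cylinder U : (forall y, U y -> exists n, cylinder n y `<=` U) -> open U.
Proof.
move=> h; rewrite openE => y /h [n hn]; exact: filterS hn (cylinder_nbhs n y).
Qed.

Lemma open_measurable_config U : open U -> measurable U.
Proof. exact: (@sub_sigma_algebra _ setT (@open (config A))). Qed.

Lemma closed_measurable_config U : closed U -> measurable U.
Proof.
move=> h; rewrite -[U]setCK; apply: measurableC; apply: open_measurable_config.
exact: closed_openC.
Qed.

Lemma continuous_measurable_config (G : config A -> config A) :
  continuous G -> measurable_fun setT G.
Proof.
move=> cG; apply: (@measurability _ _ _ _ setT G (@open (config A))) => // _ [V oV <-].
rewrite setTI; apply: open_measurable_config.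
by apply: open_comp => // y _; exact: cG.
Qed.

(** The union of the [k]-cylinders meeting [B]: clopen for every [B], and decreasing to [B] when [B]
    is closed, so it approximates closed sets from outside. *)
Definition hull k B : set (config A) := [set y | cylinder k y `&` B !=set0].

Lemma sub_hull k B : B `<=` hull k B.
Proof. by move=> y By; exists y. Qed.

Lemma hull_cylinder k B y : hull k B y -> cylinder k y `<=` hull k B.
Proof. by move=> [z [h Bz]] t ht; exists z; rewrite (cylinder_eq ht). Qed.

Lemma open_hull k B : open (hull k B).
Proof. by apply: open_cylinder => y hy; exists k; exact: hull_cylinder. Qed.

Lemma closed_hull k B : closed (hull k B).
Proof.
rewrite -[hull k B]setCK; apply: open_closedC; apply: open_cylinder => y hy.
exists k => z hz /hull_cylinder h; apply: hy; apply: h; exact: cylinder_sym.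
Qed.

Lemma measurable_hull k B : measurable (hull k B).
Proof. exact: open_measurable_config (open_hull k B). Qed.

Lemma hull_decr B : {homo hull^~ B : n m / (n <= m)%N >-> (m <= n)%O}.
Proof.
move=> n m nm; apply/subsetPset => y [z [h Bz]]; exists z; split=> //.
exact: cylinder_le h.
Qed.

Lemma bigcap_hull B : closed B -> \bigcap_k hull k B = B.
Proof.
move=> cB; apply/seteqP; split=> [y hy|y By k _]; last exact: sub_hull.
apply: contrapT => nBy; have [|n hn] := @nbhs_cylinder y (~` B).
  by apply: open_nbhs_nbhs; split=> //; exact: closed_openC.
have [z [/hn]] := hy n I; exact.
Qed.

End topology.

(** * Translations, periodic configurations, local rule and tubes *)

Section cellular_automaton_theory.
Context {A : alphabetType}.
Implicit Types (x y z : config A).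

Definition translate (j : int) x : config A := fun i => x (i + j).

Lemma translate0 x : translate 0 x = x.
Proof. by apply/funext => i; rewrite /translate addr0. Qed.

Lemma translateD j k x : translate j (translate k x) = translate (j + k) x.
Proof. by apply/funext => i; rewrite /translate addrA. Qed.

Lemma shift_mapE x : shift_map x = translate 1 x.
Proof. by []. Qed.

Lemma periodic_mul (T : Type) (u : int -> T) (p : nat) :
  (forall i, u (i + p%:Z) = u i) -> forall (k : int) i, u (i + k * p%:Z) = u i.
Proof.
move=> up.
have upn (n : nat) i : u (i + n%:Z * p%:Z) = u i.
  elim: n i => [|n IH] i; first by rewrite mul0r addr0.
  by rewrite -[in RHS]IH -[in RHS]up; congr u; lia.
move=> [n|n] i; first exact: upn.
by rewrite -(upn n.+1); congr u; lia.
Qed.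

Definition periodic_configs (p : nat) : set (config A) :=
  [set z | translate p%:Z z = z].

Lemma periodic_configsP p z : periodic_configs p z <-> forall i, z (i + p%:Z) = z i.
Proof.
split=> [h i|h]; first by rewrite -[in RHS]h.
by apply/funext => i; rewrite -[in RHS]h.
Qed.

(** Finite words are a countable type, so coding periodic configurations by words allows countable
    unions of null sets over them. *)
Definition periodize (s : seq A) : config A :=
  fun i => nth point s `|(i %% (size s)%:Z)%Z|%N.

Lemma periodize_periodic s : periodic_configs (size s) (periodize s).
Proof. by apply/periodic_configsP => i; rewrite /periodize modzDr. Qed.

Lemma periodizeE p z : (0 < p)%N -> periodic_configs p z ->
  z = periodize (mkseq (fun i => z i%:Z) p).
Proof.
move=> p0 /periodic_configsP zp; apply/funext => i; rewrite /periodize size_mkseq.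
have i0 : 0 <= (i %% p%:Z)%Z by apply: modz_ge0; lia.
rewrite nth_mkseq; last by have := @ltz_pmod i p%:Z; lia.
rewrite gez0_abs // [in LHS](divz_eq i p%:Z) addrC.
exact: (@periodic_mul A z p).
Qed.

Lemma finite_periodic_configs p : (0 < p)%N -> finite_set (periodic_configs p).
Proof.
move=> p0; apply: (@sub_finite_set _ _ (range (fun t : p.-tuple A => periodize t))).
  move=> z /(periodizeE p0) zE.
  by exists (Tuple (introT eqP (size_mkseq (fun i : nat => z i%:Z) p))).
exact: finite_image finite_finset.
Qed.

Context (F : config A -> config A).
Hypothesis F_CA : cellular_automaton F.

Lemma CA_translate j x : F (translate j x) = translate j (F x).
Proof.
have Fn (n : nat) y : F (translate n%:Z y) = translate n%:Z (F y).
  elim: n => [|n IH]; first by rewrite !translate0.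
  have h u : translate n.+1%:Z u = shift_map (translate n%:Z u).
    by rewrite shift_mapE translateD; congr translate; lia.
  by rewrite !h F_CA.2 IH.
case: j => n; first by rewrite Fn.
(* Negative translations: cancel against the opposite translation, which already commutes with
   [F]. *)
have h : - (n.+1)%:Z + (n.+1)%:Z = 0 by rewrite addNr.
rewrite NegzE -[LHS]translate0 -[in LHS]h -translateD -Fn.
by rewrite translateD addrN translate0.
Qed.

Lemma CA_iter_translate n j x : iter n F (translate j x) = translate j (iter n F x).
Proof. by elim: n => //= n ->; rewrite CA_translate. Qed.

Lemma CA_periodic_iter n p z : periodic_configs p z -> periodic_configs p (iter n F z).
Proof. by rewrite /periodic_configs /= => h; rewrite -CA_iter_translate h. Qed.

Lemma CA_continuous_iter n : continuous (iter n F).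
Proof.
elim: n => [|n IH] x; first exact: cvg_id.
exact: (@continuous_comp _ _ _ (iter n F) F x (IH x) (F_CA.1 _)).
Qed.

(** Half of the Curtis-Hedlund-Lyndon theorem: by continuity each point has a cylinder on which the
    letter of [F] at 0 is constant, and compactness gives a common width. *)
Lemma CA_radius : exists r : nat, forall x y,
  cylinder r x y -> F y 0 = F x 0.
Proof.
have [r _ hr] : \forall n \near \oo,
    [set: config A] `<=` (fun x => forall y, cylinder n x y -> F y 0 = F x 0).
  move/compact_near_coveringP: (@config_compact A); apply=> x _.
  have [n hn] : exists n, cylinder n x `<=` [set y | F y 0 = F x 0].
    apply: nbhs_cylinder; exact: (F_CA.1 x _ (coord_nbhs 0 (F x))).
  exists (cylinder n x, [set m | (n <= m)%N]).
    by split; [exact: cylinder_nbhs|exists n].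
  move=> [x' m] /= [xx' nm] y x'y; rewrite (hn x') // hn //.
  exact: cylinder_trans xx' (cylinder_le nm x'y).
by exists r => x; apply: (hr r) => //=.
Qed.

Lemma CA_local : exists r : nat, forall x y (j : int),
  (forall k : int, j - r%:Z <= k <= j + r%:Z -> y k = x k) -> F y j = F x j.
Proof.
have [r hr] := CA_radius; exists r => x y j h.
have := hr (translate j x) (translate j y); rewrite !CA_translate /translate add0r.
by apply=> i hi; apply: h; lia.
Qed.

(* Two walls carrying the same time evolution enclose a word whose spatially
   periodic repetition evolves, between the walls, as [y] does. *)
Lemma CA_walls_periodic (r p : nat) y :
  (forall x y (j : int),
    (forall k : int, j - r%:Z <= k <= j + r%:Z -> y k = x k) -> F y j = F x j) ->
  (r < p)%N ->
  (forall n (j : int), - r%:Z <= j <= r%:Z -> iter n F y (j + p%:Z) = iter n F y j) ->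
  exists2 z, periodic_configs p z &
    forall n (j : int), 0 <= j <= p%:Z -> iter n F y j = iter n F z j.
Proof.
move=> hr rp hy; pose z := periodize (mkseq (fun i => y i%:Z) p).
have zp : periodic_configs p z.
  by have := periodize_periodic (mkseq (fun i => y i%:Z) p); rewrite size_mkseq.
(* Agreement on one period spreads to [r] cells on either side: the walls of [y] and the periodicity
   of [z] both allow a shift by [p], and [r < p] makes it land in the period. This margin is what
   the local rule needs for the next time step. *)
have ext n : (forall j : int, 0 <= j < p%:Z -> iter n F y j = iter n F z j) ->
    forall j : int, - r%:Z <= j <= p%:Z + r%:Z -> iter n F y j = iter n F z j.
  move=> h j hj; have /periodic_configsP zn := CA_periodic_iter n zp.
  case: (ltP j 0) => j0; first by rewrite -zn -hy; [apply: h; lia|lia].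
  case: (ltP j p%:Z) => jp; first by apply: h; lia.
  rewrite -[j](subrK p%:Z) zn hy; last by lia.
  by apply: h; lia.
have zy n (j : int) : - r%:Z <= j <= p%:Z + r%:Z -> iter n F y j = iter n F z j.
  move: j; elim: n => [|n IH]; apply: ext => j hj.
    rewrite /= /z /periodize size_mkseq modz_small; last by lia.
    by rewrite nth_mkseq; [rewrite gez0_abs //; lia|lia].
  by rewrite /=; apply: hr => k hk; apply: IH; lia.
by exists z => // n j hj; apply: zy; lia.
Qed.

Lemma tube_sym m x y : tube F m x y -> tube F m y x.
Proof. by move=> h i j hj; rewrite h. Qed.

Lemma tube_trans m x y z : tube F m x y -> tube F m y z -> tube F m x z.
Proof. by move=> h1 h2 i j hj; rewrite h2 // h1. Qed.

Lemma tube_eq m x y : tube F m x y -> tube F m y = tube F m x.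
Proof.
move=> h; apply/seteqP; split=> z; first exact: tube_trans.
by apply: tube_trans; exact: tube_sym.
Qed.

Lemma tube_step m x y : tube F m x y -> tube F m (F x) (F y).
Proof. by move=> h i j hj; rewrite -!iterSr; exact: h. Qed.

Lemma closed_tube m x : closed (tube F m x).
Proof.
rewrite -[tube F m x]setCK; apply: open_closedC; rewrite openE => y hy.
have [i [j [hj hij]]] : exists i (j : int),
    - m%:Z <= j <= m%:Z /\ iter i F y j <> iter i F x j.
  apply: contrapT => h; apply: hy => i j hj; apply: contrapT => hij; apply: h.
  by exists i, j.
have h : nbhs y [set t | iter i F t j = iter i F y j].
  exact: (@CA_continuous_iter i y _ (coord_nbhs j (iter i F y))).
by apply: filterS h => t /= ht /(_ i j hj); rewrite ht.
Qed.

End cellular_automaton_theory.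

(** * Lebesgue density for cylinders and closed sets *)

Section density.
Context {A : alphabetType} {R : realType} (nu : probability (config A) R).
Implicit Types (x y z : config A) (B : set (config A)).

Lemma cylinder_measurable n x : measurable (cylinder n x).
Proof.
apply: open_measurable_config; apply: open_cylinder => y h.
by exists n; rewrite (cylinder_eq h).
Qed.

(** The pair of [n] and this word is a countable code for the cylinder. *)
Definition window n x : seq A := [seq x (k%:Z - n%:Z) | k <- iota 0 n.*2.+1].

Lemma window_eqP n x y : window n y = window n x <-> cylinder n x y.
Proof.
split=> [/eq_in_map h j hj|h].
  have := h (absz (j + n%:Z)); rewrite mem_iota gez0_abs; last by lia.
  by rewrite addrK; apply; lia.
by apply/eq_in_map => k; rewrite mem_iota => hk; apply: h; lia.
Qed.

Local Open Scope ereal_scope.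

(* The sparse cylinders include those of measure zero, so that the density
   theorem below also yields that almost every point lies in the support. *)
Definition sparse B q n x : Prop :=
  nu (cylinder n x) <= (q.+1%:R)%:E * nu (cylinder n x `\` B).

(** A stopping time: the condition at [n] depends only on the [n]-cylinder, and [n] is unique, so
    the cylinders stopped in this way are pairwise disjoint. *)
Definition first_sparse B q k n x : Prop :=
  [/\ (k <= n)%N, sparse B q n x &
      forall i, (k <= i < n)%N -> ~ sparse B q i x].

Lemma first_sparse_cylinder B q k n x y : cylinder n x y ->
  first_sparse B q k n x -> first_sparse B q k n y.
Proof.
move=> xy [kn bn bi]; have e i : (i <= n)%N -> cylinder i y = cylinder i x.
  by move=> /cylinder_le /(_ _ xy)/cylinder_eq.
split=> // [|i /[dup] /andP[_ /ltnW /e ei] /bi]; by rewrite /sparse ?ei ?e.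
Qed.

Lemma first_sparse_unique B q k n m x :
  first_sparse B q k n x -> first_sparse B q k m x -> n = m.
Proof.
move=> [kn bn fn] [km bm fm]; have [|nm|//] := ltngtP n m.
- by move=> nm; case: (fm n) => //; rewrite kn.
- by case: (fn m) => //; rewrite km.
Qed.

(** Each piece is empty or one stopped cylinder inside [hull k B]. The numbering by codes turns the
    stopped cylinders into a sequence, as countable additivity requires. *)
Let piece B q k (i : nat) : set (config A) :=
  if pickle_inv i is Some (n, w)
  then [set y | [/\ hull k B y, first_sparse B q k n y & window n y = w]]
  else set0.

Let piece_cylinder B q k i y : piece B q k i y ->
  exists n, first_sparse B q k n y /\ piece B q k i = cylinder n y.
Proof.
rewrite /piece; case: pickle_inv => // -[n w] /= [hy fy wy].
exists n; split=> //; apply/seteqP; split=> z /=.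
  by move=> [_ _ wz]; apply/window_eqP; rewrite wz.
move=> yz; split; last by rewrite -wy; apply/window_eqP.
- by apply: hull_cylinder hy _ _; case: fy => kn _ _; exact: cylinder_le yz.
- exact: first_sparse_cylinder fy.
Qed.

Let piece_measurable B q k i : measurable (piece B q k i).
Proof.
have [->//|/set0P[y hy]] := eqVneq (piece B q k i) set0.
by have [n [_ ->]] := piece_cylinder hy; exact: cylinder_measurable.
Qed.

Let piece_trivIset B q k : trivIset setT (piece B q k).
Proof.
move=> i j _ _ [y]; rewrite /piece.
case Ei: (pickle_inv i) => [[n w]|] [] //; case Ej: (pickle_inv j) => [[m v]|] //.
move=> [_ f1 w1] [_ f2 w2].
have nm := first_sparse_unique f1 f2; subst m; subst w v.
by rewrite -[LHS](@pickle_invK (nat * seq A)%type) -[RHS](@pickle_invK (nat * seq A)%type) Ei Ej.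
Qed.

Let piece_sparse B q k i : measurable B ->
  nu (piece B q k i) <= (q.+1%:R)%:E * nu (piece B q k i `\` B).
Proof.
move=> mB.
have [->|/set0P[y hy]] := eqVneq (piece B q k i) set0.
  by rewrite measure0 set0D measure0 mule0.
by have [n [[_ h _] ->]] := piece_cylinder hy.
Qed.

Let pieces_sparse B q k : measurable B ->
  nu (\bigcup_i piece B q k i) <=
    (q.+1%:R)%:E * nu ((\bigcup_i piece B q k i) `\` B).
Proof.
move=> mB; rewrite setDE setI_bigcupl !measure_bigcup //.
- rewrite -nneseriesZl //; apply: lee_nneseries => [i _ _|i _]; first exact: measure_ge0.
  by rewrite -setDE; exact: (piece_sparse q k i mB).
- by move=> i _; apply: measurableI => //; exact: measurableC.
- by apply: trivIset_setIr.
Qed.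

(** Points of [B] with sparse cylinders at arbitrarily large scales lie in the union [G k] of the
    pieces for every [k]. Summing the sparsity inequality over the disjoint pieces bounds the
    measure of [G k] by [q.+1] times that of the part of [hull k B] outside [B], which tends to
    0. *)
Lemma closed_density B : closed B ->
  {ae nu, forall y, B y ->
     forall q, \forall n \near \oo, ~ sparse B q n y}.
Proof.
move=> cB; have mB := closed_measurable_config cB.
suff h q : {ae nu, forall y, B y -> \forall n \near \oo, ~ sparse B q n y}.
  have := ae_foralln h; apply: filterS => y hy By q; exact: hy.
have mD k : measurable (hull k B `\` B).
  by apply: measurableD => //; exact: measurable_hull.
pose G k := \bigcup_i piece B q k i.
have mG k : measurable (G k) by apply: bigcup_measurable => i _.
exists (\bigcap_k G k); split.
- by apply: bigcapT_measurable.
- have le k : nu (\bigcap_k G k) <= (q.+1%:R)%:E * nu (hull k B `\` B).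
    apply: (@le_trans _ _ (nu (G k))).
      apply: le_measure; rewrite ?inE //; first exact: bigcapT_measurable.
      exact: bigcap_inf.
    apply: le_trans (pieces_sparse _ _ mB) _.
    rewrite lee_pmul2l ?lte_fin ?ltr0n //.
    apply: le_measure; rewrite ?inE; [by apply: measurableD => //; exact: mG|exact: mD|].
    apply: setSD => y [i _].
    by rewrite /piece; case: pickle_inv => // -[n w] [].
  have cv : (fun k => (q.+1%:R)%:E * nu (hull k B `\` B)) @ \oo --> (0 : \bar R).
    rewrite -(mule0 (q.+1%:R)%:E); apply: cvgeZl => //.
    have -> : 0 = nu (\bigcap_k (hull k B `\` B)).
      rewrite (_ : \bigcap_k _ = set0) ?measure0 //; apply/seteqP; split=> // y h.
      have [_ nBy] := h 0%N I; apply: nBy; rewrite -(bigcap_hull cB) => k _.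
      by have [] := h k I.
    apply: nonincreasing_cvg_mu.
    + by rewrite ltey_eq fin_num_measure //; exact: mD.
    + by move=> i; exact: mD.
    + by apply: bigcapT_measurable.
    + by move=> n m nm; apply/subsetPset; apply: setSD; apply/subsetPset; exact: hull_decr.
  apply/eqP; rewrite eq_le measure_ge0 andbT.
  by apply: (cvge_to_ge cv); apply: nearW.
- move=> y /= /not_implyP[By ny] k _.
  have ex : exists n, `[< (k <= n)%N /\ sparse B q n y >].
    apply: contrapT => h; apply: ny; exists k => // n /= kn sn; apply: h.
    by exists n; apply/asboolP.
  (* The least sparse scale from [k] on determines the piece containing [y]. *)
  case: (ex_minnP ex) => n /asboolP[kn sn] hmin.
  exists (pickle (n, window n y)) => //; rewrite /piece pickleK_inv; split=> //.
    exact: sub_hull.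
  split=> // i /andP[ki lin] si.
  by have := hmin i (introT (asboolP _) (conj ki si)); lia.
Qed.

End density.

(** * Recurrence under the shift and periodic tubes for [mu] *)

Section recurrence.
Context {A : alphabetType} {R : realType} (mu : probability (config A) R).
Hypothesis mu_ergodic : shift_ergodic mu.
Implicit Types (x y z : config A) (W : set (config A)).

Lemma translate_continuous j : continuous (@translate A j).
Proof.
move=> x U /nbhs_cylinder[n hn]; apply: filterS (cylinder_nbhs (n + absz j)%N x).
by move=> y h; apply: hn => i hi; rewrite /translate; apply: h; lia.
Qed.

Lemma measurable_translate j W : measurable W -> measurable [set y | W (translate j y)].
Proof.
move=> mW; rewrite -[X in measurable X]setTI.
exact: (continuous_measurable_config (@translate_continuous j)).
Qed.

(** The intersection keeps the common positive measure by continuity from above; being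
    shift-invariant, it has measure 1 by ergodicity. *)
Lemma ergodic_limsup (U : (set (config A))^nat) :
  (forall n, measurable (U n)) -> {homo U : n m / (n <= m)%N >-> (m <= n)%O} ->
  (forall n, mu (U n) = mu (U 0%N)) -> (0 < mu (U 0%N))%E ->
  shift_map @^-1` (\bigcap_n U n) = \bigcap_n U n ->
  {ae mu, forall y, forall n, U n y}.
Proof.
move=> mU dU eU U0 sU; have mI := bigcapT_measurable mU.
have fU : (mu (U 0%N) < +oo)%E by rewrite ltey_eq fin_num_measure.
have I0 : mu (\bigcap_n U n) = mu (U 0%N).
  have := nonincreasing_cvg_mu fU mU mI dU.
  rewrite (_ : mu \o U = cst (mu (U 0%N))); last exact/funext.
  by move=> /(cvg_unique _ (cvg_cst _)) => <-.
have I1 : mu (\bigcap_n U n) = 1%E.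
  by case: (mu_ergodic.2 _ mI sU) => // h; move: U0; rewrite -I0 h ltxx.
exists (~` \bigcap_n U n); split; first exact: measurableC.
  by rewrite probability_setC // I1 subee.
by move=> y /= hy h; apply: hy => n; apply: h.
Qed.

(** The sign [c], 1 or -1, selects the side on which [W] is visited, at distance at least [n]. *)
Let visits (c : int) W n : set (config A) :=
  \bigcup_(k in [set k | (n <= k)%N]) [set y | W (translate (c * k%:Z) y)].

Let visits_homo c W : {homo visits c W : n m / (n <= m)%N >-> (m <= n)%O}.
Proof.
move=> n m nm; apply/subsetPset => y [k /= mk hk]; exists k => //=.
exact: leq_trans mk.
Qed.

Let measurable_visits c W n : measurable W -> measurable (visits c W n).
Proof. by move=> mW; apply: bigcup_measurable => k _; exact: measurable_translate. Qed.

Let visits_pos c W : measurable W -> (0 < mu W)%E -> (0 < mu (visits c W 0))%E.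
Proof.
move=> mW W0; apply: (lt_le_trans W0); apply: le_measure; rewrite ?inE //.
  exact: measurable_visits.
by move=> y Wy; exists 0%N => //=; rewrite mulr0 translate0.
Qed.

(** The shift preimage raises the index of [visits 1 W] by one and lowers that of [visits (-1) W] by
    one. Hence on each side all these sets have the same measure and their intersection is
    invariant. *)
Lemma ergodic_recurrence W : measurable W -> (0 < mu W)%E ->
  {ae mu, forall y, forall n : nat,
    (exists2 k, (n <= k)%N & W (translate k%:Z y)) /\
    (exists2 k, (n <= k)%N & W (translate (- k%:Z) y))}.
Proof.
move=> mW W0.
have tr (a b : int) u : a = b -> W (translate a u) -> W (translate b u) by move->.
have sR n : shift_map @^-1` visits 1 W n = visits 1 W n.+1.
  apply/seteqP; split=> y /= [k /= nk]; rewrite ?shift_mapE ?translateD => h.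
    by exists k.+1 => //=; apply: tr h; lia.
  case: k nk h => // k nk h; exists k => //=.
  by rewrite ?shift_mapE translateD; apply: tr h; lia.
have sL n : shift_map @^-1` visits (-1) W n.+1 = visits (-1) W n.
  apply/seteqP; split=> y /= [k /= nk]; rewrite ?shift_mapE ?translateD => h.
    case: k nk h => // k nk h; exists k => //=.
    by apply: tr h; lia.
  exists k.+1 => //=.
  by rewrite ?shift_mapE translateD; apply: tr h; lia.
have eR n : mu (visits 1 W n) = mu (visits 1 W 0).
  by elim: n => // n <-; rewrite -sR mu_ergodic.1 //; exact: measurable_visits.
have eL n : mu (visits (-1) W n) = mu (visits (-1) W 0).
  by elim: n => // n <-; rewrite -(sL n) mu_ergodic.1 //; exact: measurable_visits.
have iR : shift_map @^-1` (\bigcap_n visits 1 W n) = \bigcap_n visits 1 W n.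
  rewrite preimage_bigcap; apply/seteqP; split=> y h n _.
    have := h n I; rewrite sR.
    by have /subsetPset := visits_homo 1 W (leqnSn n); apply.
  by rewrite sR; apply: h.
have iL : shift_map @^-1` (\bigcap_n visits (-1) W n) = \bigcap_n visits (-1) W n.
  rewrite preimage_bigcap; apply/seteqP; split=> y h n _.
    by rewrite -(sL n); exact: (h n.+1 I).
  have /subsetPset := visits_homo (-1) W (leqnSn n); apply.
  by have := h n I; rewrite -(sL n).
have HR := ergodic_limsup (fun n => measurable_visits 1 n mW) (visits_homo 1 W) eR
  (visits_pos 1 mW W0) iR.
have HL := ergodic_limsup (fun n => measurable_visits (-1) n mW) (visits_homo (-1) W) eL
  (visits_pos (-1) mW W0) iL.
apply: filterS2 HR HL => y hR hL n; split.
  by have [k nk] := hR n; rewrite /= mul1r => Wk; exists k.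
by have [k nk] := hL n; rewrite /= mulN1r => Wk; exists k.
Qed.

Context (F : config A -> config A).
Hypothesis F_CA : cellular_automaton F.

Lemma measurable_tube m x : measurable (tube F m x).
Proof. by apply: closed_measurable_config; exact: closed_tube. Qed.

(** Were the tube null, all density quotients would be 0 and could not tend to 1. *)
Lemma equicontinuous_point_tube_gt0 x m :
  equicontinuous_point mu F x -> (0 < mu (tube F m x))%E.
Proof.
move=> [pos /(_ m) cv]; rewrite lt0e measure_ge0 andbT; apply/eqP => h0.
have h n : mu (cylinder n x `&` tube F m x) = 0%E.
  apply/eqP; rewrite eq_le measure_ge0 andbT -h0; apply: le_measure.
  - rewrite inE; apply: measurableI; first exact: cylinder_measurable.
    exact: measurable_tube.
  - by rewrite inE; exact: measurable_tube.
  - exact: subIsetr.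
have e : (fun n => fine (mu (cylinder n x `&` tube F m x)) /
                   fine (mu (cylinder n x))) = cst (0 : R).
  by apply/funext => n; rewrite h mul0r.
have := cvg_lim (@Rhausdorff R) cv; rewrite e lim_cst.
  by move=> E; have := @oner_neq0 R; rewrite -E eqxx.
exact: Rhausdorff.
Qed.

Lemma ae_tube_periodic m : (exists x, equicontinuous_point mu F x) ->
  {ae mu, forall y, exists p, exists2 z, periodic_configs p.+1 z & tube F m z y}.
Proof.
move=> [x x_eq]; have [r hr] := CA_local F_CA.
have mW : measurable (tube F r x) by exact: measurable_tube.
have := ergodic_recurrence mW (equicontinuous_point_tube_gt0 r x_eq).
(* With [k1] and [k2] beyond [m + r], the window from [-m] to [m] lies between the wall centres
   [-k1] and [k2], and [r < k1 + k2]. Translating by [-k1] puts the left centre at 0 and the right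
   one at [k1 + k2]. *)
apply: filterS => y /(_ (m + r).+1)[[k2 k2n W2] [k1 k1n W1]].
have [||z zp hz] := @CA_walls_periodic _ _ F_CA r (k1 + k2) (translate (- k1%:Z) y) hr.
- by lia.
- move=> n j hj; rewrite (W1 n j hj) -(W2 n j hj) !(CA_iter_translate F_CA) /translate.
  by congr (iter n F y); lia.
exists (k1 + k2).-1, (translate k1%:Z z).
  rewrite prednK; last by lia.
  by rewrite /periodic_configs /= translateD addrC -translateD zp.
move=> i j hj.
rewrite (CA_iter_translate F_CA) [RHS]/translate -hz; last by lia.
by rewrite (CA_iter_translate F_CA) /translate addrK.
Qed.

End recurrence.

(** * Comparison of [mu] with its Cesaro limit on invariant closed sets *)

Section cesaro.
Context {A : alphabetType} {R : realType} (mu mu_c : probability (config A) R).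
Context (F : config A -> config A).
Hypothesis F_CA : cellular_automaton F.
Hypothesis mu_cE : cesaro_limit mu F mu_c.
Implicit Types U E : set (config A).

Lemma clopen_indic_continuous U : open U -> closed U ->
  continuous (\1_U : config A -> R).
Proof.
move=> oU cU x.
suff h : nbhs x [set y | \1_U y = \1_U x :> R].
  by have c := @cvg_near_cst _ R (\1_U x) (\1_U : config A -> R) (nbhs x) _ h; exact: c.
have [Ux|nUx] := pselect (U x).
  have h : nbhs x U by apply: open_nbhs_nbhs.
  by apply: filterS h => y Uy; rewrite /= !indicE !mem_set.
have h : nbhs x (~` U) by apply: open_nbhs_nbhs; split=> //; exact: closed_openC.
by apply: filterS h => y Uy; rewrite /= !indicE !memNset.
Qed.

Lemma measurable_iter n : measurable_fun setT (iter n F).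
Proof. apply: continuous_measurable_config; exact: (@CA_continuous_iter _ _ F_CA n). Qed.

Lemma cesaro_mean_measure n : exists m : {measure set (config A) -> \bar R},
  cesaro_mean mu F n = m.
Proof.
have n0 : 0 <= n%:R^-1 :> R by rewrite invr_ge0.
(* The measure instance of [pushforward] takes a measurability proof that
   canonical inference cannot supply, hence the explicit instance name. *)
pose nu i : {measure set (config A) -> \bar R} :=
  measure_function_pushforward__canonical__measure_function_Measure mu (measurable_iter i).
by exists (mscale (NngNum n0) (msum nu n)).
Qed.

(** The indicator of a clopen set is continuous, hence a test function for weak-* convergence. *)
Lemma cesaro_limit_clopen U : open U -> closed U ->
  (fun n => cesaro_mean mu F n U) @ \oo --> mu_c U.
Proof.
move=> oU cU; have mU := open_measurable_config oU.
have e n : (\int[cesaro_mean mu F n]_x (\1_U x)%:E)%E = cesaro_mean mu F n U.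
  by have [m ->] := cesaro_mean_measure n; rewrite integral_indic // setIT.
have := mu_cE (clopen_indic_continuous oU cU).
by rewrite integral_indic // setIT (funext e).
Qed.

(** Orbits starting in [E] stay in [E], so every preimage of [U] under an iterate of [F] contains
    [E], and the averages inherit the lower bound [mu E]. *)
Lemma cesaro_limit_ge_clopen E U : measurable E -> F @` E `<=` E -> E `<=` U ->
  open U -> closed U -> (mu E <= mu_c U)%E.
Proof.
move=> mE FE EU oU cU; have mU := open_measurable_config oU.
(* Start at 1: the mean of index 0 is the zero measure. *)
apply: (cvge_to_ge (cesaro_limit_clopen oU cU)); exists 1%N => // n /= n0.
have n0R : (0 < n%:R :> R) by rewrite ltr0n.
have -> : mu E = ((n%:R^-1)%:E * \sum_(i < n) mu E)%E.
  have fE : mu E \is a fin_num by exact: fin_num_measure.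
  rewrite -(fineK fE) sumEFin sumr_const card_ord -EFinM -[X in (_ * X)%:E]mulr_natl mulrA.
  by rewrite mulVf ?mul1r // gt_eqF.
rewrite lee_pmul2l ?lte_fin ?invr_gt0 //.
apply: lee_sum => i _; apply: le_measure; rewrite ?inE //.
  by rewrite -[X in measurable X]setTI; exact: measurable_iter.
move=> y Ey; apply: EU; elim: (nat_of_ord i) => //= k IH.
by apply: FE; exists (iter k F y).
Qed.

(* Clopen hulls shrink to the closed set, so no portmanteau theorem is needed. *)
Lemma cesaro_limit_ge_closed E : closed E -> F @` E `<=` E -> (mu E <= mu_c E)%E.
Proof.
move=> cE FE; have mE := closed_measurable_config cE.
have cv : (fun k => mu_c (hull k E)) @ \oo --> mu_c E.
  rewrite -[in X in _ --> X](bigcap_hull cE).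
  apply: nonincreasing_cvg_mu.
  - by rewrite ltey_eq fin_num_measure //; exact: measurable_hull.
  - by move=> k; exact: measurable_hull.
  - by rewrite bigcap_hull.
  - exact: hull_decr.
apply: (cvge_to_ge cv); apply: nearW => k.
apply: cesaro_limit_ge_clopen => //; [exact: sub_hull|exact: open_hull|exact: closed_hull].
Qed.

End cesaro.

(** * From density to equicontinuity, and periodic tubes for the Cesaro limit *)

Section conclusion.
Context {A : alphabetType} {R : realType}.
Context (F : config A -> config A).
Hypothesis F_CA : cellular_automaton F.

Lemma equicontinuous_point_density (nu : probability (config A) R) y :
  (forall m q, \forall n \near \oo, ~ sparse nu (tube F m y) q n y) ->
  equicontinuous_point nu F y.
Proof.
move=> h; split=> [n|m].
  (* Failure of sparsity is a strict inequality, so it makes small cylinders have positive measure;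
     the [n]-cylinder contains such a one. *)
  have [N _ hN] := h 0%N 0%N; have := hN (maxn n N) (leq_maxr _ _).
  move/negP; rewrite -ltNge => h1.
  have h2 : (0 < nu (cylinder (maxn n N) y))%E.
    apply: le_lt_trans h1; apply: mule_ge0 => //.
  apply: lt_le_trans h2 _; apply: le_measure; rewrite ?inE; try exact: cylinder_measurable.
  exact: cylinder_le (leq_maxl _ _).
apply/cvgrPdist_lt => e e0.
(* A cylinder that is not sparse for [q] has a proportion below [1 / q.+1] outside the tube. *)
have [q hq] : exists q : nat, q.+1%:R^-1 < e by have [q] := ltr_add_invr e0; rewrite add0r; exists q.
apply: filterS (h m q) => n /negP; rewrite -ltNge.
have mC := cylinder_measurable n y; have mB := measurable_tube F_CA m y.
set C := cylinder n y in mC *; set B := tube F m y in mB *.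
have fC : nu C \is a fin_num by exact: fin_num_measure.
have fI : nu (C `&` B) \is a fin_num by apply: fin_num_measure; exact: measurableI.
have fD : nu (C `\` B) \is a fin_num by apply: fin_num_measure; exact: measurableD.
have CE : fine (nu C) = fine (nu (C `&` B)) + fine (nu (C `\` B)).
  by rewrite -fineD // addeC -measureDI.
rewrite -(fineK fC) -(fineK fD) -EFinM lte_fin => hlt.
have d0 : 0 <= fine (nu (C `\` B)) by exact: fine_ge0.
have c0 : 0 < fine (nu C) by apply: le_lt_trans hlt; exact: mulr_ge0.
have -> : 1 - fine (nu (C `&` B)) / fine (nu C) = fine (nu (C `\` B)) / fine (nu C).
  by rewrite -[X in X - _](divff (lt0r_neq0 c0)) -mulrBl CE addrAC subrr add0r.
rewrite ger0_norm; last by rewrite divr_ge0 // ltW.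
apply: lt_trans hq; rewrite ltr_pdivrMr // -ltr_pdivrMl // invrK.
exact: hlt.
Qed.

(** Bounding the period by [N] leaves finitely many tubes, hence a closed union; [F] preserves
    periods, so the union is also mapped into itself. *)
Let traps m N : set (config A) :=
  \bigcup_(p in `I_N) \bigcup_(z in periodic_configs p.+1) tube F m z.

Let closed_traps m N : closed (traps m N).
Proof.
apply: closed_bigcup => // p _; apply: closed_bigcup => [|z _].
  exact: finite_periodic_configs.
exact: closed_tube.
Qed.

Let traps_invariant m N : F @` traps m N `<=` traps m N.
Proof.
move=> _ [y [p pN [z zp zy]] <-]; exists p => //; exists (F z); last exact: tube_step.
exact: (CA_periodic_iter F_CA 1 zp).
Qed.

Let measurable_traps m N : measurable (traps m N).
Proof. by apply: closed_measurable_config; exact: closed_traps. Qed.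

Lemma ae_cesaro_limit_tube_periodic (mu mu_c : probability (config A) R) m :
  shift_ergodic mu -> (exists x, equicontinuous_point mu F x) ->
  cesaro_limit mu F mu_c ->
  {ae mu_c, forall y, exists s, tube F m (periodize s) y}.
Proof.
move=> mu_erg mu_eq mu_cE.
have mT : measurable (\bigcup_N traps m N).
  by apply: bigcupT_measurable => N; exact: measurable_traps.
have mu1 : mu (\bigcup_N traps m N) = 1%E.
  have [B [mB B0 hB]] := ae_tube_periodic mu_erg F_CA m mu_eq.
  apply/eqP; rewrite eq_le probability_le1 //=.
  have <- : mu (~` B) = 1%E by rewrite probability_setC // B0 sube0.
  apply: le_measure; rewrite ?inE //; first exact: measurableC.
  move=> y yB; apply: contrapT => hy; apply: yB; apply: hB => -[p [z zp zy]].
  by apply: hy; exists p.+1 => //; exists p => //=; exists z.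
have mu_c1 : mu_c (\bigcup_N traps m N) = 1%E.
  apply/eqP; rewrite eq_le probability_le1 //= -mu1.
  have cv : (fun N => mu (traps m N)) @ \oo --> mu (\bigcup_N traps m N).
    apply: nondecreasing_cvg_mu => // i j ij; apply/subsetPset => y [p /= pi hp].
    by exists p => //=; exact: leq_trans ij.
  (* Each trap set has at least as much mass for [mu_c] as for [mu], and the [mu]-masses increase to
     1. *)
  apply: (cvge_to_le cv); apply: nearW => N.
  apply: (@le_trans _ _ (mu_c (traps m N))).
    exact: (cesaro_limit_ge_closed F_CA mu_cE).
  by apply: le_measure; rewrite ?inE //; exact: bigcup_sup.
exists (~` \bigcup_N traps m N); split; first exact: measurableC.
  by rewrite probability_setC // mu_c1 subee.
move=> y /= hy [N _ [p _ [z zp zy]]]; apply: hy.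
by exists (mkseq (fun i => z i%:Z) p.+1); rewrite -periodizeE.
Qed.

End conclusion.

(** * Density of countably many tubes at almost every point *)

Theorem theorem2 (R : realType) (A : alphabetType)
    (F : config A -> config A) (mu : probability (config A) R)
    (F_CA : cellular_automaton F)
    (mu_ergodic : shift_ergodic mu)
    (mu_eq : exists x : config A, equicontinuous_point mu F x)
    (mu_c : probability (config A) R)
    (mu_cE : cesaro_limit mu F mu_c) :
  equicontinuous_CA mu_c F.
Proof.
have periodic := ae_foralln (fun m =>
  ae_cesaro_limit_tube_periodic F_CA m mu_ergodic mu_eq mu_cE).
(* Running through words by their codes [i] keeps the quantification countable. *)
have dense : {ae mu_c, forall y, forall m i s, pickle_inv i = Some s ->
    tube F m (periodize s) y ->
    forall q, \forall n \near \oo, ~ sparse mu_c (tube F m (periodize s)) q n y}.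
  apply: ae_foralln => m; apply: ae_foralln => i.
  case E : (pickle_inv i) => [s|]; last by apply: filterE.
  have cB : closed (tube F m (periodize s)) by exact: closed_tube.
  by have := closed_density mu_c cB; apply: filterS => y hy _ [<-].
apply: filterS2 periodic dense => y hp hd.
apply: (equicontinuous_point_density F_CA) => m q.
(* Tubes of a fixed width are equivalence classes, so the tube of [y] is the tube of a periodic
   configuration, whose density at [y] is known. *)
have [s sy] := hp m; rewrite (tube_eq sy).
exact: (hd m (pickle s) s (pickleK_inv s) sy q).
Qed.
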